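(* Given the characteristic polynomial $F(\sigma)=F_{\boldsymbol{\alpha},\boldsymbol{\ell}}(\sigma)$ of an admissible curvilinear polygon $\mathcal{P}(\boldsymbol{\alpha},\boldsymbol{\ell})$, one can recover the number of vertices $n$ and the number of exceptional angles $K\ge0$. Moreover: (a) If there are no exceptional angles, that is $K=0$, one can recover the vector of side lengths $\boldsymbol{\ell}$ modulo cyclic shifts and a reversal of orientation, and, once the enumeration of vertices is fixed, one can also recover the cosine vector $\mathbf{c}_{\boldsymbol{\alpha}}$ modulo a global change of sign. (b) If the number of exceptional angles is $K\ge1$, then for each exceptional boundary component $\mathcal{Y}_\kappa$, $\kappa=1,\dots,K$, one can determine whether it is even or odd, and obtain the number $n_\kappa$ of its constituent boundary arcs, the vector $\boldsymbol{\ell}^{(\kappa)}$ of their lengths modulo a reversal of orientation, and, once the orientation is fixed, the vector $\mathbf{c}^{(\kappa)}$ modulo a global change of sign. Here ''can recover'' means that the data is determined by $F$: if two admissible curvilinear polygons have the same characteristic polynomial, then they have the same $n$ and $K$; if $K=0$, then after a cyclic re-enumeration and possibly a reversal of orientation of one of them their length vectors coincide and their cosine vectors coincide up to a global sign; if $K\ge1$, then their exceptional boundary components can be put in a one-to-one correspondence such that corresponding components have the same parity, the same number of arcs and, after possibly reversing the orientation of one of them, the same length vectors and the same cosine vectors up to a global sign (the sign depending on the component).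
   Context: Curvilinear polygons. A curvilinear polygon $\mathcal{P}(\boldsymbol{\alpha},\boldsymbol{\ell})$ with $n\ge 1$ vertices is a bounded connected planar domain with connected Lipschitz boundary that consists of $n$ smooth sides $I_1,\dots,I_n$ of lengths $\boldsymbol{\ell}=(\ell_1,\dots,\ell_n)\in\mathbb{R}_+^n$ and has interior angles $\boldsymbol{\alpha}=(\alpha_1,\dots,\alpha_n)\in(0,\pi)^n$ at the vertices $V_1,\dots,V_n$. Sides and vertices are enumerated clockwise and indices are cyclic ($n+1\equiv 1$); the angle $\alpha_j$ at $V_j$ is formed by $I_j$ and $I_{j+1}$. All angles are always assumed to be less than $\pi$. Characteristic polynomial. For $\boldsymbol{\alpha}\in(0,\pi)^n$, $\boldsymbol{\ell}\in\mathbb{R}_+^n$, $$F_{\boldsymbol{\alpha},\boldsymbol{\ell}}(\sigma)=\sum_{\boldsymbol{\zeta}\in\{1\}\times\{\pm1\}^{n-1}}\mathfrak{p}_{\boldsymbol{\zeta}}\cos\big(|\boldsymbol{\ell}\cdot\boldsymbol{\zeta}|\,\sigma\big)-\prod_{j=1}^n\sin\frac{\pi^2}{2\alpha_j},\qquad \mathfrak{p}_{\boldsymbol{\zeta}}=\prod_{j:\ \zeta_j\ne\zeta_{j+1}}\cos\frac{\pi^2}{2\alpha_j},$$ where $j$ runs over $\{1,\dots,n\}$, $\zeta_{n+1}\equiv\zeta_1$, and an empty product equals $1$. It is regarded as a function of $\sigma\in\mathbb{R}$. Special and exceptional angles. With $\mathbb{N}=\{1,2,\dots\}$, an angle is special if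 it belongs to $\{\pi/(2k+1): k\in\mathbb{N}\}$ and exceptional if it belongs to $\{\pi/(2k): k\in\mathbb{N}\}$. The parity of an exceptional angle $\alpha=\pi/(2k)$ is $\cos\frac{\pi^2}{2\alpha}=(-1)^k$. The cosine vector is $\mathbf{c}_{\boldsymbol{\alpha}}=(c_1,\dots,c_n)$, $c_j=\cos\frac{\pi^2}{2\alpha_j}$. Admissible. $\mathcal{P}(\boldsymbol{\alpha},\boldsymbol{\ell})$ is admissible if none of its angles is special and $\ell_1,\dots,\ell_n$ are incommensurable over $\{-1,0,+1\}$, i.e. $\sum_j\epsilon_j\ell_j=0$ with all $\epsilon_j\in\{-1,0,1\}$ implies all $\epsilon_j=0$. Re-enumeration. A cyclic re-enumeration applies the same cyclic shift of indices to $\boldsymbol{\ell}$ and $\mathbf{c}$; a change of orientation replaces $\boldsymbol{\ell}=(\ell_1,\ell_2,\dots,\ell_n)$, $\mathbf{c}=(c_1,\dots,c_n)$ by $(\ell_1,\ell_n,\dots,\ell_2)$, $(c_n,c_{n-1},\dots,c_1)$. Exceptional boundary components. If $\mathcal{P}$ has $K\ge1$ exceptional angles, the corresponding vertices split $\partial\mathcal{P}$ into $K$ exceptional boundary components $\mathcal{Y}_1,\dots,\mathcal{Y}_K$ (chains of consecutive sides between consecutive exceptional vertices; if $K=1$ there is one component, both of whose ends are the same vertex). The component $\mathcal{Y}_\kappa$ consists of $n_\kappa$ sides (arcs); $\boldsymbol{\ell}^{(\kappa)}=(\ell^{(\kappa)}_1,\dots,\ell^{(\kappa)}_{n_\kappa})$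 is the vector of their lengths in order, $\alpha^{(\kappa)}_1,\dots,\alpha^{(\kappa)}_{n_\kappa-1}$ are the non-exceptional angles between consecutive sides, and $\mathbf{c}^{(\kappa)}=\big(\cos\frac{\pi^2}{2\alpha^{(\kappa)}_1},\dots,\cos\frac{\pi^2}{2\alpha^{(\kappa)}_{n_\kappa-1}}\big)$ is its cosine vector. Reversing the orientation of a component reverses both vectors. $\mathcal{Y}_\kappa$ is even if the parities of the exceptional angles at its two ends coincide, and odd otherwise. *)

(* Defs.v *)
From HB Require Import structures.
From mathcomp Require Export all_boot all_order all_algebra.
From mathcomp Require Export all_classical all_reals all_analysis.

Set Implicit Arguments.
Unset Strict Implicit.
Unset Printing Implicit Defensive.

Export Order.TTheory GRing.Theory Num.Theory.
Export numFieldNormedType.Exports.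

Local Open Scope classical_set_scope.
Local Open Scope ring_scope.

(* Indices start at 0: the side I_j and the vertex V_j of the text are those
   with index j - 1 in 'I_n, and [ordS] is the cyclic successor. *)

Section Geometry.
Variable R : realType.

Definition rotate (a : R) (u : R * R) : R * R :=
  (cos a * u.1 - sin a * u.2, sin a * u.1 + cos a * u.2).

Definition frontier (Om : set (R * R)) : set (R * R) := closure Om `\` interior Om.

(* Near each boundary point, in some orthonormal frame, the domain is the part
   of a box lying below the graph of a Lipschitz function. *)
Definition lipschitz_boundary (Om : set (R * R)) : Prop :=
  forall p, frontier Om p ->
  exists (a r h : R) (f : R -> R),
    [/\ 0 < r, 0 < h, (exists k : R, k.-lipschitz f), f 0 = 0 &
      forall x y, `|x| < r -> `|y| < h ->
        (Om (p + rotate a (x, y)) <-> y < f x)].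

(* A curve is smooth on a closed interval iff it is the restriction of a
   curve that is smooth on the line, so sides are given by curves on R. *)
Definition smooth_curve (g : R -> R * R) : Prop :=
  forall (k : nat) (t : R), derivable (derive1n k g) t 1.

Definition right_normal (u : R * R) : R * R := (u.2, - u.1).

(* [side j], restricted to [0, l_j], is the arc-length parametrisation of the
   j-th side in the clockwise direction, so that [Om] lies on its right; the
   j-th vertex is the endpoint of the j-th side.  Turning the backward tangent
   of side j at that vertex counterclockwise by the interior angle gives the
   forward tangent of the next side. *)
Record is_curvilinear_polygon (n : nat) (alpha l : n.-tuple R)
    (Om : set (R * R)) (side : 'I_n -> R -> R * R) : Prop := {
  polygon_vertices_gt0 : (0 < n)%N;
  polygon_angles : forall j, 0 < tnth alpha j < pi;
  polygon_lengths : forall j, 0 < tnth l j;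
  polygon_open : open Om;
  polygon_connected : connected Om;
  polygon_bounded : bounded_set Om;
  polygon_frontier_connected : connected (frontier Om);
  polygon_frontier_lipschitz : lipschitz_boundary Om;
  polygon_smooth : forall j, smooth_curve (side j);
  polygon_arc_length : forall j t, 0 <= t <= tnth l j ->
    (derive1 (side j) t).1 ^+ 2 + (derive1 (side j) t).2 ^+ 2 = 1;
  polygon_frontier :
    frontier Om = \bigcup_(j : 'I_n) [set side j t | t in `[0, tnth l j]];
  polygon_vertices : forall j, side j (tnth l j) = side (ordS j) 0;
  polygon_simple : forall i j s t,
    0 <= s < tnth l i -> 0 <= t < tnth l j -> side i s = side j t ->
    i = j /\ s = t;
  polygon_clockwise : forall j t, 0 < t < tnth l j ->
    \forall e \near 0^'+, Om (side j t + e *: right_normal (derive1 (side j) t));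
  polygon_interior_angle : forall j,
    derive1 (side (ordS j)) 0 =
      rotate (tnth alpha j) (- derive1 (side j) (tnth l j))
}.

End Geometry.

Section Trigonometry.
Variable R : realType.

Definition special (a : R) : Prop :=
  exists2 k : nat, (0 < k)%N & a = pi / (2 * k + 1)%:R.

Definition exceptional (a : R) : Prop :=
  exists2 k : nat, (0 < k)%N & a = pi / (2 * k)%:R.

Definition cos_angle (a : R) : R := cos (pi ^+ 2 / (2 * a)).

Definition cosine_vector n (alpha : n.-tuple R) : n.-tuple R :=
  map_tuple cos_angle alpha.

Definition incommensurable n (l : n.-tuple R) : Prop :=
  forall e : 'I_n -> R, (forall j, e j \in [:: -1; 0; 1]) ->
    \sum_j e j * tnth l j = 0 -> forall j, e j = 0.

Definition admissible n (alpha l : n.-tuple R) : Prop :=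
  (forall j, ~ special (tnth alpha j)) /\ incommensurable l.

(* A sign vector zeta is encoded by z : {ffun 'I_n -> bool} with
   zeta_j = (-1) ^+ z j; the condition zeta_1 = 1 is then z 0 = false. *)
Definition charF n (alpha l : n.-tuple R) (sigma : R) : R :=
  \sum_(z : {ffun 'I_n -> bool} | [forall j : 'I_n, (val j == 0%N) ==> ~~ z j])
     (\prod_(j | z j != z (ordS j)) cos_angle (tnth alpha j)) *
     cos (`|\sum_j tnth l j * (-1) ^+ z j| * sigma)
  - \prod_j sin (pi ^+ 2 / (2 * tnth alpha j)).

Definition exceptional_vertex n (alpha : n.-tuple R) : finType :=
  {j : 'I_n | `[< exceptional (tnth alpha j) >]}.

Definition nb_exceptional n (alpha : n.-tuple R) : nat :=
  #|exceptional_vertex alpha|.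

Definition reverse_lengths (l : seq R) : seq R :=
  if l is x :: s then x :: rev s else [::].

Definition orient_lengths (b : bool) (l : seq R) : seq R :=
  if b then reverse_lengths l else l.

Definition orient_cosines (b : bool) (c : seq R) : seq R :=
  if b then rev c else c.

Definition eq_up_to_sign (c c' : seq R) : Prop :=
  c = c' \/ c = [seq - x | x <- c'].

(* The exceptional component that starts at the exceptional vertex v: its sides
   are those after v up to the next exceptional vertex, which is v itself if
   there is no other one. The j-th vertex ends the j-th side, so the vertices
   met after v carry the same indices as the sides, the last of them being the
   other end of the component. *)
Definition indices_after n (j : 'I_n) : seq 'I_n :=
  traject (@ordS n) (ordS j) n.

Section Component.
Variables (n : nat) (alpha l : n.-tuple R) (v : exceptional_vertex alpha).

Definition component_size : nat :=
  (find (fun j => `[< exceptional (tnth alpha j) >])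
     (indices_after (val v))).+1.

Definition component_sides : seq 'I_n :=
  take component_size (indices_after (val v)).

Definition component_lengths : seq R :=
  [seq tnth l j | j <- component_sides].

Definition component_cosines : seq R :=
  [seq cos_angle (tnth alpha j) | j <- take component_size.-1 component_sides].

Definition component_even : Prop :=
  cos_angle (tnth alpha (val v)) =
  cos_angle (tnth alpha (last (val v) component_sides)).

End Component.

Definition same_component n m (alpha l : n.-tuple R) (beta k : m.-tuple R)
    (v : exceptional_vertex alpha) (w : exceptional_vertex beta) : Prop :=
  [/\ component_even v <-> component_even w,
      component_size v = component_size w &
      (component_lengths l v = component_lengths k w /\
       eq_up_to_sign (component_cosines v) (component_cosines w)) \/
      (component_lengths l v = rev (component_lengths k w) /\
       eq_up_to_sign (component_cosines v) (rev (component_cosines w)))].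

End Trigonometry.

(* Main.v *)
Require Import Defs.
From mathcomp Require Import all_boot all_order all_algebra.
From mathcomp Require Import all_classical all_reals all_analysis.
From mathcomp Require Import finset ring lra zify.

(** The characteristic polynomial is a finite sum of cosines minus a constant.
    Signed sums [l . zeta] are nonzero and, up to a global sign, pairwise
    distinct by incommensurability, and no angle is special, so all coefficients
    are nonzero.  By the linear independence of cosines ([cos_family_coeff]),
    [F] therefore determines the set of all signed sums, the coefficient of each
    of them, and the constant ([charF_match], [charF_const]).

    The largest signed sum is the total length, and the other ones give all sums
    of subsets of the lengths; as these are pairwise distinct they determine the
    lengths, one after the other in increasing order ([length_match]).  Hence
    two admissible polygons with the same [F] have the same number of sides, and
    there is a bijection [p] between their sides which preserves lengths.
    Consider the cyclic graph whose nodes are the sides and whose edges are the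
    vertices of the polygon, the vertex [j] being weighted by its cosine [c j].
    The coefficient of [zeta] is the weight of the cut of this graph into the
    sides with [zeta = 1] and those with [zeta = -1].  So [p] also preserves the
    weights of cuts ([recover_sides]).

    It remains to recover the cyclic graph from its cut weights [w].  For two
    distinct sides [a] and [b],
      [w {a} * w {b} = w {a, b} * (product of the c j ^+ 2 over the vertices j
       shared by a and b)],
    and a vertex is exceptional exactly when [c j ^+ 2 = 1].  With at least three
    sides, this shows which sides share a non-exceptional vertex, and gives the
    value of [c j ^+ 2] there; with one or two sides the constant term of [F]
    gives the [c j ^+ 2] instead ([vertex_matching_exists]).  The cut weight of
    a single side is the product of the cosines at its ends, so that the signs
    of consecutive cosines determine each other ([vertex_sign]).

    Without exceptional vertices, [p] preserves adjacency in an [n]-cycle, hence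
    is a rotation or a reflection ([recover_cycle]).  Otherwise removing the
    exceptional vertices leaves disjoint paths, which are the exceptional
    components; [p] maps each of them onto one of the other polygon, in the same
    or in the opposite order ([component_match]).  The cut weight of the set of
    sides of a component is the product of the cosines [1] or [-1] at its two
    ends, that is, its parity ([component_cut]).  Exchanging the polygons gives
    an injection of components in the other direction, so that the
    correspondence of components is bijective. *)

Local Open Scope ring_scope.

Set Implicit Arguments.
Unset Strict Implicit.
Unset Printing Implicit Defensive.

(** * Trigonometry of the angles *)

Section Angles.
Variable R : realType.
Implicit Types a x : R.

Lemma sin_eq0_natmul x : 0 <= x -> sin x = 0 -> exists k : nat, x = pi *+ k.
Proof.
move=> x_ge0 sx0; have pi0 := @pi_gt0 R.
have xpi_ge0 : 0 <= x / pi by rewrite divr_ge0 // ltW.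
have /andP[] := truncn_itv xpi_ge0; set k := Num.truncn _ => le_k lt_k.
exists k; apply/eqP; rewrite -subr_eq0 -[_ == 0]negbK; apply/negP => y_neq0.
have y_ge0 : 0 <= x - pi *+ k.
  by rewrite subr_ge0 -mulr_natl -ler_pdivlMr.
have y_lt : x - pi *+ k < pi.
  by rewrite ltrBlDr -mulrS -mulr_natl -ltr_pdivrMr.
have : 0 < sin (x - pi *+ k) by rewrite sin_gt0_pi // lt_def y_neq0 y_ge0.
have := alternatingn (@sinDpi R) k (x - pi *+ k).
rewrite subrK sx0 => /esym/eqP; rewrite mulf_eq0 signr_eq0 /= => /eqP->.
by rewrite ltxx.
Qed.

Section OneAngle.
Variable a : R.
Hypothesis a_itv : 0 < a < pi.

Let a_gt0 : 0 < a. Proof. by case/andP: a_itv. Qed.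

Let x_gt : pi / 2 < pi ^+ 2 / (2 * a).
Proof.
case/andP: a_itv => _ a_lt; have pi0 := @pi_gt0 R.
rewrite ltr_pdivlMr ?mulr_gt0 // (_ : pi / 2 * (2 * a) = pi * a); last by field.
by rewrite expr2 ltr_pM2l.
Qed.

Let angleE (p b x : R) : p != 0 -> b != 0 -> x != 0 ->
  p ^+ 2 / (2 * b) = p * x -> b = p / (2 * x).
Proof.
move=> p0 b0 x0 /(congr1 (fun y => y * b / (p * x))) e.
transitivity (p * x * b / (p * x)); first by field; rewrite x0 p0.
by rewrite -e; field; rewrite b0 x0 p0.
Qed.

Lemma exceptional_cos2 : exceptional a <-> cos_angle a ^+ 2 = 1.
Proof.
have pi0 := @pi_gt0 R; have pi_neq0 : pi != 0 :> R by rewrite gt_eqF.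
have a0 : a != 0 by rewrite gt_eqF.
rewrite /cos_angle; split=> [[k k_gt0 ->]|].
  have k0 : k%:R != 0 :> R by rewrite pnatr_eq0 -lt0n.
  have -> : pi ^+ 2 / (2 * (pi / (2 * k)%:R)) = 0 + pi *+ k :> R.
    rewrite natrM add0r -mulr_natr; move: (pi : R) pi_neq0 => p p0.
    by field; rewrite k0 p0.
  by rewrite (alternatingn (@cosDpi R)) cos0 mulr1 sqrr_sign.
move/eqP; rewrite cos2sin2 subr_eq addrC -subr_eq subrr eq_sym sqrf_eq0.
move=> /eqP/sin_eq0_natmul[|k xE].
  by rewrite ltW // (lt_trans _ x_gt) // divr_gt0.
have k_gt0 : (0 < k)%N.
  rewrite lt0n; apply/eqP => k0; move: x_gt.
  by rewrite xE k0 mulr0n ltNge ltW // divr_gt0.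
exists k => //; rewrite natrM; apply: angleE => //.
  by rewrite pnatr_eq0 -lt0n.
by rewrite xE mulr_natr.
Qed.

Lemma special_cos_eq0 : cos_angle a = 0 -> special a.
Proof.
have pi0 := @pi_gt0 R; have pi_neq0 : pi != 0 :> R by rewrite gt_eqF.
have a0 : a != 0 by rewrite gt_eqF.
rewrite /cos_angle => cx0.
have := sinBpihalf (pi ^+ 2 / (2 * a)); rewrite cx0 oppr0.
move=> /sin_eq0_natmul[|k xE]; first by rewrite subr_ge0 ltW.
have k_gt0 : (0 < k)%N.
  rewrite lt0n; apply/eqP => k0; move: x_gt.
  by rewrite -subr_gt0 xE k0 mulr0n ltxx.
exists k => //.
have k0 : k%:R + 1 / 2 != 0 :> R by rewrite gt_eqF // addr_gt0 // ?ltr0n.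
have -> : (2 * k + 1)%:R = 2 * (k%:R + 1 / 2) :> R.
  by rewrite natrD natrM; field.
apply: angleE => //; move/eqP: xE; rewrite subr_eq => /eqP->.
by rewrite mulrDr mulr_natr mul1r.
Qed.

End OneAngle.
End Angles.

(** * Linear independence of cosines *)

Section CosineSums.
Variable R : realType.

(** Replacing [f sigma] by [(f (sigma + h) + f (sigma - h)) / 2] multiplies
    [cos (w * sigma)] by [cos (w * h)], so the powers of this operator turn a
    vanishing sum of cosines into vanishing power sums. *)
Lemma cos_sum_power (s : seq (R * R)) (h : R) :
  (forall sigma, \sum_(x <- s) x.1 * cos (x.2 * sigma) = 0) ->
  forall (k : nat) sigma,
    \sum_(x <- s) x.1 * cos (x.2 * h) ^+ k * cos (x.2 * sigma) = 0.
Proof.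
move=> s0; elim=> [|k IHk] sigma.
  by under eq_bigr do rewrite expr0 mulr1.
have half : (0 + 0) / 2 = 0 :> R by rewrite addr0 mul0r.
rewrite -[RHS]half -[in X in X + _](IHk (sigma + h)) -[in X in _ + X](IHk (sigma - h)).
rewrite -big_split mulr_suml /=; apply: eq_bigr => x _.
by rewrite mulrDr mulrBr cosD cosB exprS; field.
Qed.

(** Evaluating the vanishing power sums at [sigma = 0] gives
    [\sum_x x.1 * q.[cos (x.2 * h)] = 0] for every polynomial [q]; take [q]
    vanishing at all the points [cos (x.2 * h)] but [cos (t * h)]. *)
Lemma cos_sum_coeff (s : seq (R * R)) :
  (forall x, x \in s -> 0 <= x.2) ->
  (forall sigma, \sum_(x <- s) x.1 * cos (x.2 * sigma) = 0) ->
  forall t, \sum_(x <- s | x.2 == t) x.1 = 0.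
Proof.
move=> s_ge0 s0 t; have pi0 := @pi_gt0 R.
have [/hasP[x0 x0s /eqP tE]|/hasPn nt] := boolP (has (fun x => x.2 == t) s); last first.
  by rewrite big_seq_cond big1 // => x /andP[xs]; rewrite (negPf (nt x xs)).
have t_ge0 : 0 <= t by rewrite -tE s_ge0.
pose M : R := 1 + \sum_(x <- s) x.2.
have le_M x : x \in s -> x.2 <= M.
  move=> xs; rewrite /M (big_rem x) //= addrCA lerDl addr_ge0 //.
  by rewrite big_seq sumr_ge0 // => y /mem_rem /s_ge0.
have M_gt0 : 0 < M.
  by rewrite (lt_le_trans ltr01) // lerDl big_seq sumr_ge0.
(* All frequencies times [h] lie in [0, pi], where cos is injective. *)
pose h := pi / M; have h_gt0 : 0 < h by rewrite divr_gt0.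
have itv x : x \in s -> x.2 * h \in `[0, pi].
  move=> xs; rewrite in_itv /= mulr_ge0 ?s_ge0 ?(ltW h_gt0) //=.
  by rewrite /h mulrCA -[leRHS]mulr1 ler_pM2l // ler_pdivrMr // mul1r le_M.
have tM : t * h \in `[0, pi] by rewrite -tE itv.
have poly0 (q : {poly R}) : \sum_(x <- s) x.1 * q.[cos (x.2 * h)] = 0.
  transitivity (\sum_(x <- s) \sum_(i < size q)
      q`_i * (x.1 * cos (x.2 * h) ^+ i * cos (x.2 * 0))).
    apply: eq_bigr => x _; rewrite horner_coef mulr_sumr; apply: eq_bigr => i _.
    by rewrite mulr0 cos0 mulr1 mulrCA.
  rewrite exchange_big big1 //= => i _.
  by rewrite -mulr_sumr cos_sum_power // mulr0.
pose q := \prod_(x <- s | x.2 != t) ('X - (cos (x.2 * h))%:P).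
have qt : q.[cos (t * h)] != 0.
  rewrite horner_prod big_seq_cond prodf_seq_neq0; apply/allP => x xs.
  apply/implyP => /andP[_ xt]; rewrite hornerXsubC subr_eq0.
  apply: contra xt => /eqP eq_cos; rewrite eq_sym; apply/eqP.
  have h_neq0 : h != 0 by rewrite gt_eqF.
    exact: (mulIf h_neq0 (cos_inj tM (itv x xs) eq_cos)).
have := poly0 q; rewrite (bigID (fun x => x.2 == t)) /= addrC big1_seq ?add0r; last first.
  move=> x /andP[xt xs]; rewrite /q horner_prod (big_rem x) //= xt hornerXsubC.
  by rewrite subrr mul0r mulr0.
rewrite (eq_bigr (fun x => x.1 * q.[cos (t * h)])) => [|x /eqP-> //].
by rewrite -mulr_suml => /eqP; rewrite mulf_eq0 (negPf qt) orbF => /eqP.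
Qed.

(** Two finite sums of cosines with positive frequencies and a constant term
    agree as functions only if their constant terms agree and, at each
    frequency, the total coefficients agree. *)
Lemma cos_family_coeff (I J : finType) (P : pred I) (Q : pred J)
    (a w : I -> R) (b v : J -> R) (C D : R) :
  (forall i, 0 < w i) -> (forall j, 0 < v j) ->
  (forall sigma, \sum_(i | P i) a i * cos (w i * sigma) - C =
                 \sum_(j | Q j) b j * cos (v j * sigma) - D) ->
  C = D /\ forall t, 0 < t ->
    \sum_(i | P i && (w i == t)) a i = \sum_(j | Q j && (v j == t)) b j.
Proof.
move=> w_gt0 v_gt0 eq_sums.
pose s : seq (R * R) := [seq (a i, w i) | i <- enum P] ++
  [seq (- b j, v j) | j <- enum Q] ++ [:: (D - C, 0)].
have s_ge0 x : x \in s -> 0 <= x.2.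
  rewrite !mem_cat => /or3P[/mapP[i _ ->]|/mapP[j _ ->]|].
  - exact/ltW/w_gt0.
  - exact/ltW/v_gt0.
  - by rewrite inE => /eqP->.
have s0 sigma : \sum_(x <- s) x.1 * cos (x.2 * sigma) = 0.
  rewrite !big_cat !big_map !big_enum big_seq1 /= mul0r cos0 mulr1.
  under [X in _ + (X + _)]eq_bigr => j _ do rewrite mulNr.
  rewrite sumrN; move/eqP: (eq_sums sigma); rewrite subr_eq => /eqP->.
  by ring.
have coeff t : \sum_(i | P i && (w i == t)) a i -
    \sum_(j | Q j && (v j == t)) b j + (if 0 == t then D - C else 0) = 0.
  rewrite -[RHS](cos_sum_coeff s_ge0 s0 t) !big_cat !big_map !big_enum_cond /=.
  by rewrite sumrN addrA big_cons big_nil addr0.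
split=> [|t t_gt0].
  have := coeff 0; rewrite eqxx !big_pred0 => [|j|i]; rewrite ?gt_eqF ?andbF //.
  by rewrite subr0 add0r => /eqP; rewrite subr_eq0 => /eqP.
have := coeff t; rewrite lt_eqF // addr0 => /eqP.
by rewrite subr_eq0 => /eqP.
Qed.

End CosineSums.

(** * Recovering the frequencies, the cut weights and the sides *)

(** The signed sum of the lengths [l], for the sign vector that is [-1] exactly
    on [A].  Sign vectors are encoded by such sets throughout, so that a global
    change of sign is [~: A]. *)
Definition balance (R : realType) n (l : 'I_n -> R) (A : {set 'I_n}) : R :=
  \sum_j l j * (-1) ^+ (j \in A).

(** The product of the weights [c j] over those vertices [j] exactly one of
    whose two sides, [j] and [ordS j], belongs to [A]: the weight of the cut [A]
    in the cyclic graph whose nodes are the sides of the polygon and whose edges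
    are its vertices. *)
Definition cut_weight (R : realType) n (c : 'I_n -> R) (A : {set 'I_n}) : R :=
  \prod_(j | (j \in A) != (ordS j \in A)) c j.

Section Balance.
Variables (R : realType) (n : nat).
Implicit Types (l : n.-tuple R) (c : 'I_n -> R) (A B : {set 'I_n}).

Lemma balanceC (l : 'I_n -> R) A : balance l (~: A) = - balance l A.
Proof.
rewrite /balance -sumrN; apply: eq_bigr => j _; rewrite in_setC.
by case: (j \in A); rewrite ?expr1 ?expr0 ?mulrN1 ?mulr1 ?opprK.
Qed.

Lemma balance_subset_sum (l : 'I_n -> R) A :
  balance l A = balance l set0 - 2 * \sum_(j in A) l j.
Proof.
rewrite /balance mulr_sumr [X in _ - X]big_mkcond /= -sumrB; apply: eq_bigr => j _.
rewrite in_set0; case: ifP => _; rewrite ?expr1 ?expr0; ring.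
Qed.

Lemma incommensurable_eq l A B : incommensurable l ->
  \sum_j tnth l j * ((j \in A)%:R - (j \in B)%:R) = 0 -> A = B.
Proof.
move=> l_inc sum0; apply/setP => j.
have e_in i : (i \in A)%:R - (i \in B)%:R \in [:: -1; 0; 1 : R].
  by case: (i \in A); case: (i \in B);
    rewrite ?subrr ?subr0 ?sub0r !inE eqxx ?orbT.
have := l_inc _ e_in; under eq_bigr do rewrite mulrC.
move=> /(_ sum0 j) /eqP; rewrite subr_eq0 eqr_nat.
by case: (j \in A); case: (j \in B).
Qed.

Lemma subset_sum_inj l A B : incommensurable l ->
  \sum_(j in A) tnth l j = \sum_(j in B) tnth l j -> A = B.
Proof.
have sumE C : \sum_(j in C) tnth l j = \sum_j tnth l j * (j \in C)%:R.
  by rewrite big_mkcond; apply: eq_bigr => j _; case: ifP; rewrite ?mulr1 ?mulr0.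
rewrite !sumE => l_inc /eqP; rewrite -subr_eq0 -sumrB => /eqP sum0.
apply: incommensurable_eq (l_inc) _; rewrite -[RHS]sum0.
by apply: eq_bigr => j _; rewrite mulrBr.
Qed.

Lemma incommensurable_inj l : incommensurable l -> injective (tnth l).
Proof.
move=> l_inc i j eq_l; apply/set1P; rewrite (_ : [set j] = [set i]) ?set11 //.
by apply: (subset_sum_inj l_inc); rewrite !big_set1.
Qed.

Lemma balance_inj l : incommensurable l -> injective (balance (tnth l)).
Proof.
move=> l_inc A B /eqP.
rewrite balance_subset_sum [in X in _ == X]balance_subset_sum.
rewrite (inj_eq (addrI _)) eqr_opp => /eqP/mulfI; rewrite pnatr_eq0 => /(_ isT).
exact: subset_sum_inj.
Qed.

Lemma balance_neq0 l A : (0 < n)%N -> incommensurable l ->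
  balance (tnth l) A != 0.
Proof.
move=> n_gt0 l_inc; apply/eqP => bA0.
have /(balance_inj l_inc)/setP/(_ (Ordinal n_gt0)) :
  balance (tnth l) A = balance (tnth l) (~: A) by rewrite balanceC bA0 oppr0.
by rewrite in_setC; case: (_ \in A).
Qed.

Lemma eq_norm_balance l A B : incommensurable l ->
  `|balance (tnth l) A| = `|balance (tnth l) B| -> A = B \/ A = ~: B.
Proof.
move=> l_inc /eqP; rewrite eqr_norm2 -balanceC.
by case/orP => /eqP/(balance_inj l_inc); [left | right].
Qed.

Lemma cut_weightC c A : cut_weight c (~: A) = cut_weight c A.
Proof.
by apply: eq_bigl => j; rewrite !in_setC; case: (j \in A); case: (_ \in A).
Qed.

Lemma cut_weight_neq0 c A : (forall j, c j != 0) -> cut_weight c A != 0.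
Proof. by move=> c0; apply/prodf_neq0. Qed.

End Balance.

Section Matching.
Variable R : realType.

(** The [j]-th entry of the cosine vector. *)
Definition angle_cos n (alpha : n.-tuple R) (j : 'I_n) : R :=
  cos_angle (tnth alpha j).

Lemma charF_cut_weight n (alpha l : n.-tuple R) (n_gt0 : (0 < n)%N) sigma :
  charF alpha l sigma =
  \sum_(A : {set 'I_n} | Ordinal n_gt0 \notin A)
    cut_weight (angle_cos alpha) A * cos (`|balance (tnth l) A| * sigma)
  - \prod_j sin (pi ^+ 2 / (2 * tnth alpha j)).
Proof.
congr (_ - _).
rewrite (reindex (fun A : {set 'I_n} => [ffun j => j \in A])) /=; last first.
  exists (fun z : {ffun 'I_n -> bool} => [set j | z j]) => [A _|z _].
    by apply/setP => j; rewrite inE ffunE.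
  by apply/ffunP => j; rewrite ffunE inE.
apply: eq_big => [A|A _].
  apply/forallP/idP => [/(_ (Ordinal n_gt0))|iA j]; rewrite ffunE //=.
  by apply/implyP => /eqP j0; rewrite (_ : j = Ordinal n_gt0) //; apply: val_inj.
congr (_ * _); first by apply: eq_bigl => j; rewrite !ffunE.
congr (cos (_ * _)); congr (`|_|).
by apply: eq_bigr => j _; rewrite ffunE.
Qed.

(** At a frequency of [charF], there is exactly one sign vector up to a global
    sign, so the coefficient is a single cut weight. *)
Lemma cut_weight_coeff n (c : 'I_n -> R) (l : n.-tuple R) (i0 : 'I_n)
    (A : {set 'I_n}) :
  incommensurable l -> i0 \notin A ->
  \sum_(B : {set 'I_n} | (i0 \notin B) &&
      (`|balance (tnth l) B| == `|balance (tnth l) A|)) cut_weight c B =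
  cut_weight c A.
Proof.
move=> l_inc i0A; apply: big_pred1 => B /=; apply/andP/eqP => [[i0B /eqP]|-> //].
case/(eq_norm_balance l_inc) => // BE.
by move: i0B i0A; rewrite BE in_setC negbK => ->.
Qed.

Section TwoPolygons.
Variables (n m : nat) (alpha l : n.-tuple R) (alpha' l' : m.-tuple R).
Hypotheses (n_gt0 : (0 < n)%N) (m_gt0 : (0 < m)%N).
Hypotheses (l_inc : incommensurable l) (l'_inc : incommensurable l').
Hypothesis c_neq0 : forall j, angle_cos alpha j != 0.
Hypothesis eqF : forall sigma, charF alpha l sigma = charF alpha' l' sigma.

Let charF_coeff :
  \prod_j sin (pi ^+ 2 / (2 * tnth alpha j)) =
    \prod_j sin (pi ^+ 2 / (2 * tnth alpha' j)) :> R /\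
  forall t, 0 < t ->
  \sum_(A : {set 'I_n} | (Ordinal n_gt0 \notin A) &&
     (`|balance (tnth l) A| == t)) cut_weight (angle_cos alpha) A =
  \sum_(A : {set 'I_m} | (Ordinal m_gt0 \notin A) &&
     (`|balance (tnth l') A| == t)) cut_weight (angle_cos alpha') A.
Proof.
apply: cos_family_coeff => [A|A|sigma].
- by rewrite normr_gt0 balance_neq0.
- by rewrite normr_gt0 balance_neq0.
- by rewrite -!charF_cut_weight.
Qed.

Lemma charF_const : \prod_j sin (pi ^+ 2 / (2 * tnth alpha j)) =
  \prod_j sin (pi ^+ 2 / (2 * tnth alpha' j)) :> R.
Proof. by case: charF_coeff. Qed.

Lemma charF_match (A : {set 'I_n}) : exists A' : {set 'I_m},
  balance (tnth l) A = balance (tnth l') A' /\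
  cut_weight (angle_cos alpha) A = cut_weight (angle_cos alpha') A'.
Proof.
wlog i0A : A / Ordinal n_gt0 \notin A => [hwlog|].
  have [i0A|] := boolP (Ordinal n_gt0 \in A); last exact: hwlog.
  have [|A' []] := hwlog (~: A); first by rewrite in_setC negbK.
  rewrite balanceC cut_weightC => bA' wA'; exists (~: A').
  by rewrite balanceC cut_weightC -bA' opprK.
have t_gt0 : 0 < `|balance (tnth l) A| by rewrite normr_gt0 balance_neq0.
have := charF_coeff.2 _ t_gt0; rewrite cut_weight_coeff // => wA.
have [A' /andP[j0A' /eqP bA']|noA] := pickP (fun A' : {set 'I_m} =>
    (Ordinal m_gt0 \notin A') &&
    (`|balance (tnth l') A'| == `|balance (tnth l) A|)); last first.
  by move: wA; rewrite big_pred0 // => /eqP; rewrite (negPf (cut_weight_neq0 _ _)).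
rewrite -bA' cut_weight_coeff // in wA.
move/eqP: bA'; rewrite eqr_norm2 => /orP[] /eqP bA'; first by exists A'.
by exists (~: A'); rewrite balanceC cut_weightC bA' opprK.
Qed.

End TwoPolygons.


(** A length [x] of [l] is a subset sum of [l'].  If it were not a single
    length of [l'], all terms of this sum would be smaller than [x], and hence
    be lengths of [l] too, against the uniqueness of subset sums. *)
Lemma length_match_step n m (l : n.-tuple R) (l' : m.-tuple R) i :
  (forall j, 0 < tnth l' j) -> incommensurable l -> incommensurable l' ->
  (forall A : {set 'I_n}, exists A' : {set 'I_m},
    \sum_(j in A) tnth l j = \sum_(j in A') tnth l' j) ->
  (forall j, tnth l' j < tnth l i -> exists k, tnth l k = tnth l' j) ->
  exists j, tnth l' j = tnth l i.
Proof.
move=> l'_gt0 l_inc l'_inc sums smaller.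
have [/existsP[j /eqP]|/existsPn no_j] :=
  boolP [exists j, tnth l' j == tnth l i]; first by exists j.
have [A'] := sums [set i]; rewrite big_set1 => xE.
pose g j := odflt i [pick k | tnth l k == tnth l' j].
have gE j : j \in A' -> tnth l (g j) = tnth l' j.
  move=> jA'; rewrite /g; case: pickP => [k /eqP //|no_k].
  have [|k lk] := smaller j; last by have := no_k k; rewrite lk eqxx.
  rewrite lt_neqAle no_j xE (big_setD1 j jA') /= lerDl sumr_ge0 // => k _.
  exact: ltW.
have g_inj : {in A' &, injective g}.
  move=> j k jA' kA' /(congr1 (tnth l)); rewrite !gE // => eq_l'.
  exact: incommensurable_inj eq_l'.
have /setP/(_ i) : g @: A' = [set i].
  apply: (subset_sum_inj l_inc); rewrite big_set1 xE big_imset //=.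
  exact: eq_bigr.
rewrite set11 => /imsetP[j jA' iE].
by have := no_j j; rewrite [in X in _ != X]iE gE // eqxx.
Qed.

Section SideMatching.
Variables (n m : nat) (l : n.-tuple R) (l' : m.-tuple R).
Hypotheses (l_gt0 : forall j, 0 < tnth l j) (l'_gt0 : forall j, 0 < tnth l' j).
Hypotheses (l_inc : incommensurable l) (l'_inc : incommensurable l').
Hypothesis sums : forall A : {set 'I_n}, exists A' : {set 'I_m},
  \sum_(j in A) tnth l j = \sum_(j in A') tnth l' j.
Hypothesis sums' : forall A' : {set 'I_m}, exists A : {set 'I_n},
  \sum_(j in A') tnth l' j = \sum_(j in A) tnth l j.

(** Induction on the number of lengths of either family below [x]. *)
Lemma length_match x : (exists i, tnth l i = x) <-> (exists j, tnth l' j = x).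
Proof.
pose N (x : R) := (#|[set i | (tnth l i < x)%R]| + #|[set j | (tnth l' j < x)%R]|)%N.
have [k] := ubnP (N x); elim: k x => // k IHk x Nx.
have N_lt y : y < x -> (exists i, tnth l i = y) \/ (exists j, tnth l' j = y) ->
    (N y < k)%N.
  move=> yx ly; apply: (@leq_trans (N x)) => //.
  have sub : [set i | tnth l i < y] \subset [set i | tnth l i < x].
    by apply/fintype.subsetP => i; rewrite !inE => /lt_trans->.
  have sub' : [set i | tnth l' i < y] \subset [set i | tnth l' i < x].
    by apply/fintype.subsetP => i; rewrite !inE => /lt_trans->.
  case: ly => [[i li]|[j lj]]; rewrite /N.
  - rewrite -addSn leq_add ?subset_leq_card // proper_card // properEneq sub.
    rewrite andbT; apply/eqP => /setP/(_ i).
    by rewrite !inE li ltxx yx.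
  - rewrite -addnS leq_add ?subset_leq_card // proper_card // properEneq sub'.
    rewrite andbT; apply/eqP => /setP/(_ j).
    by rewrite !inE lj ltxx yx.
split=> [[i xE]|[j xE]]; subst x.
- apply: length_match_step => // j lt_j.
  by apply/IHk; [apply: N_lt => //; right; exists j | exists j].
- apply: length_match_step => // i lt_i.
  by apply/IHk; [apply: N_lt => //; left; exists i | exists i].
Qed.

Lemma side_match : exists2 p : 'I_n -> 'I_m, injective p &
  forall i, tnth l' (p i) = tnth l i.
Proof.
have ex i : exists j, tnth l' j = tnth l i by apply/length_match; exists i.
have [p pE] := fin_all_exists ex; exists p => // i j /(congr1 (tnth l')).
by rewrite !pE => /(incommensurable_inj l_inc).
Qed.

End SideMatching.
End Matching.

(** * Recovering the adjacency of the sides from the cut weights *)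

Section Successor.
Variable n : nat.
Implicit Types i j : 'I_n.

Lemma val_ordS i : ordS i = (if i.+1 == n then 0%N else i.+1) :> nat.
Proof.
rewrite /=; case: eqP => [->|/eqP i_neq]; first exact: modnn.
by rewrite modn_small // ltn_neqAle i_neq ltn_ord.
Qed.

Lemma ordS_neq i : (1 < n)%N -> ordS i != i.
Proof.
move=> n_gt1; apply/eqP => /(congr1 (@nat_of_ord n)).
by rewrite val_ordS; case: ifP => [/eqP|_]; lia.
Qed.

Lemma ordS2_neq i : (2 < n)%N -> ordS (ordS i) != i.
Proof.
move=> n_gt2; apply/eqP => /(congr1 (@nat_of_ord n)).
rewrite !val_ordS; have := ltn_ord i.
by do ![case: ifP => [/eqP|/eqP]]; lia.
Qed.

End Successor.

Section CutWeights.
Variables (R : realType) (n : nat).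
Implicit Types (c : 'I_n -> R) (i j a b : 'I_n).

Lemma cut_weight1 c i : (1 < n)%N ->
  cut_weight c [set ordS i] = c i * c (ordS i).
Proof.
move=> n_gt1; have Si := ordS_neq i n_gt1.
have eqS j : (ordS j == ordS i) = (j == i) by rewrite (inj_eq (@ordS_inj n)).
rewrite /cut_weight (bigD1 i) /=; last first.
  by rewrite !in_set1 eqxx (eq_sym i) (negPf Si).
congr (_ * _); apply: big_pred1 => j; rewrite /= !in_set1 eqS.
case: (eqVneq j i) => [->|_]; first by rewrite (eq_sym i) (negPf Si).
by case: (j == ordS i).
Qed.

(** The product of [c j ^+ 2] over the vertices [j] shared by the sides [a]
    and [b]. *)
Definition edge_weight c a b : R :=
  \prod_(j | ((j == a) && (ordS j == b)) || ((j == b) && (ordS j == a)))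
    c j ^+ 2.

Lemma edge_weightC c a b : edge_weight c a b = edge_weight c b a.
Proof. by apply: eq_bigl => j; rewrite orbC. Qed.

(** Since cut weights do not vanish, they determine the edge weights. *)
Lemma edge_weightE c a b : a != b ->
  cut_weight c [set a] * cut_weight c [set b] =
  cut_weight c [set a; b] * edge_weight c a b.
Proof.
move=> ab; rewrite /cut_weight /edge_weight.
rewrite big_mkcond [X in _ * X]big_mkcond [in RHS]big_mkcond [X in _ = _ * X]big_mkcond -!big_split /=.
apply: eq_bigr => j _; rewrite !in_set1 !in_set2.
have not_both k : ~~ ((k == a) && (k == b)).
  by apply: contraNN ab => /andP[/eqP<- /eqP<-].
move: (not_both j) (not_both (ordS j)).
by case: (j == a); case: (j == b); case: (ordS j == a); case: (ordS j == b);
  rewrite //= ?mulr1 ?mul1r.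
Qed.

Lemma edge_weight_neq1 c a b : edge_weight c a b != 1 ->
  exists j, (a = j /\ b = ordS j) \/ (a = ordS j /\ b = j).
Proof.
have [j /orP[]/andP[/eqP<- /eqP<-] _|no_j] := pickP (fun j =>
  ((j == a) && (ordS j == b)) || ((j == b) && (ordS j == a))).
- by exists j; left.
- by exists j; right.
- by rewrite /edge_weight big_pred0 ?eqxx.
Qed.

Lemma edge_weight_succ c i : (2 < n)%N -> edge_weight c i (ordS i) = c i ^+ 2.
Proof.
move=> n_gt2; apply: big_pred1 => j /=; rewrite (inj_eq (@ordS_inj n)) andbb.
case: (eqVneq j (ordS i)) => [->|_]; last by rewrite orbF.
by rewrite (negPf (ordS2_neq i n_gt2)) orbF.
Qed.

Lemma succ_pair_inj i j : (2 < n)%N ->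
  (i = j /\ ordS i = ordS j) \/ (i = ordS j /\ ordS i = j) -> i = j.
Proof.
move=> n_gt2 [[] //|[-> /eqP]]; by rewrite (negPf (ordS2_neq j n_gt2)).
Qed.

End CutWeights.

Section VertexMatching.
Variables (R : realType) (n : nat).
Implicit Types (c : 'I_n -> R) (p h : 'I_n -> 'I_n) (i j : 'I_n).

(** [forward p h i]: the sides [i] and [ordS i] that meet at the vertex [i] are
    sent by [p] to the sides that meet at the vertex [h i], in the same order;
    [backward p h i]: in the opposite order. *)
Definition forward p h i := p i = h i /\ p (ordS i) = ordS (h i).
Definition backward p h i := p i = ordS (h i) /\ p (ordS i) = h i.

(** Two cyclic systems of weights, matched by a map [p] of the sides and a map
    [h] of the vertices.  A vertex with [c i ^+ 2 = 1] is exceptional; nothing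
    is required of [h] there. *)
Record vertex_matching (c c' : 'I_n -> R) p h : Prop := VertexMatching {
  vm_cos : forall i, c i ^+ 2 != 1 -> c' (h i) ^+ 2 = c i ^+ 2;
  vm_sides : forall i, c i ^+ 2 != 1 -> forward p h i \/ backward p h i;
  vm_onto : forall j, c' j ^+ 2 != 1 -> exists2 i, c i ^+ 2 != 1 & h i = j;
  vm_inj : forall i j, c i ^+ 2 != 1 -> c j ^+ 2 != 1 -> h i = h j -> i = j
}.

Lemma edge_weight_image c c' p a b : (forall j, c j != 0) -> injective p ->
  (forall A : {set 'I_n}, cut_weight c A = cut_weight c' (p @: A)) ->
  a != b -> edge_weight c a b = edge_weight c' (p a) (p b).
Proof.
move=> c0 p_inj cutE ab; apply: (mulfI (cut_weight_neq0 [set a; b] c0)).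
rewrite -edge_weightE // !cutE imsetU !imset_set1 edge_weightE //.
by rewrite (inj_eq p_inj).
Qed.

(** A vertex [i] with [c i ^+ 2 != 1] makes the edge weight of its two sides
    different from [1], so the images of these sides share a vertex too.  Three
    sides at least are needed for two sides to share at most one vertex. *)
Lemma vertex_image c c' p i : (2 < n)%N -> (forall j, c j != 0) ->
  injective p ->
  (forall A : {set 'I_n}, cut_weight c A = cut_weight c' (p @: A)) ->
  c i ^+ 2 != 1 ->
  exists2 j, c' j ^+ 2 = c i ^+ 2 &
    (p i = j /\ p (ordS i) = ordS j) \/ (p i = ordS j /\ p (ordS i) = j).
Proof.
move=> n_gt2 c0 p_inj cutE ci.
have iS : i != ordS i by rewrite eq_sym ordS_neq // ltnW.
have := edge_weight_image c0 p_inj cutE iS; rewrite edge_weight_succ // => ciE.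
have [|j pj] := @edge_weight_neq1 _ _ c' (p i) (p (ordS i)); first by rewrite -ciE.
exists j => //; rewrite ciE; case: pj => -[-> ->]; rewrite ?(edge_weightC _ (ordS _)).
  by rewrite edge_weight_succ.
by rewrite edge_weight_succ.
Qed.

Lemma vertex_matching_gt2 c c' p : (2 < n)%N -> (forall j, c j != 0) ->
  (forall j, c' j != 0) -> injective p ->
  (forall A : {set 'I_n}, cut_weight c A = cut_weight c' (p @: A)) ->
  exists h, vertex_matching c c' p h.
Proof.
move=> n_gt2 c0 c'0 p_inj cutE.
have ex i : exists j, c i ^+ 2 != 1 -> c' j ^+ 2 = c i ^+ 2 /\
    ((p i = j /\ p (ordS i) = ordS j) \/ (p i = ordS j /\ p (ordS i) = j)).
  have [->|ci] := eqVneq (c i ^+ 2) 1; first by exists i.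
  by have [j cj pj] := vertex_image n_gt2 c0 p_inj cutE ci; exists j.
have [h hP] := fin_all_exists ex.
have h_cos i : c i ^+ 2 != 1 -> c' (h i) ^+ 2 = c i ^+ 2 by move=> /hP[].
have h_sides i : c i ^+ 2 != 1 -> forward p h i \/ backward p h i by move=> /hP[].
exists h; split=> // [j c'j|i j ci cj hij].
- pose q := invF p_inj.
  have cutE' (A : {set 'I_n}) : cut_weight c' A = cut_weight c (q @: A).
    rewrite cutE -imset_comp; congr (cut_weight _ _).
    by rewrite -[LHS]imset_id; apply: eq_imset => k /=; rewrite f_invF.
  have q_inj : injective q by apply: can_inj (f_invF p_inj).
  have [i ciE qi] := vertex_image n_gt2 c'0 q_inj cutE' c'j.
  have ci : c i ^+ 2 != 1 by rewrite ciE.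
  exists i => //; apply: succ_pair_inj => //.
  have [pq pq'] := (f_invF p_inj j, f_invF p_inj (ordS j)).
  rewrite -/q in pq pq'.
  by case: qi pq pq' => -[-> ->] pi pSi; case: (h_sides i ci) => -[hi hSi];
    [left | right | right | left]; split; congruence.
- apply: succ_pair_inj => //.
  case: (h_sides i ci) (h_sides j cj) => -[pi pSi] [] [pj pSj];
    [left | right | right | left]; split; apply: p_inj; congruence.
Qed.

End VertexMatching.

Lemma ord2_ind (Q : 'I_2 -> Prop) : Q 0 -> Q 1 -> forall i, Q i.
Proof.
move=> Q0 Q1 [[|[|//]] lt_i].
- by rewrite (_ : Ordinal _ = 0) //; apply: val_inj.
- by rewrite (_ : Ordinal _ = 1) //; apply: val_inj.
Qed.

(** With two sides the cut weights only give [c 0 * c 1]; the product of the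
    [1 - c j ^+ 2] supplies the missing information. *)
Lemma vertex_matching_2 (R : realType) (c c' : 'I_2 -> R) p : injective p ->
  (forall A : {set 'I_2}, cut_weight c A = cut_weight c' (p @: A)) ->
  \prod_j (1 - c j ^+ 2) = \prod_j (1 - c' j ^+ 2) ->
  exists h, vertex_matching c c' p h.
Proof.
move=> p_inj cutE.
have S0 : ordS (0 : 'I_2) = 1 by apply: val_inj.
have S1 : ordS (1 : 'I_2) = 0 by apply: val_inj.
have match_h h : injective h -> (forall i, c' (h i) ^+ 2 = c i ^+ 2) ->
    vertex_matching c c' p h.
  move=> h_inj hE; split=> [i _|i _|j cj|i j _ _] //.
  - have [p01 h01] : p 0 != p 1 /\ h 0 != h 1 by rewrite !inj_eq.
    rewrite /forward /backward; move: i p01 h01.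
    by apply: ord2_ind; rewrite ?S0 ?S1;
      move: (p 0) (p 1) (h 0) (h 1); do 4![apply: ord2_ind; rewrite ?S0 ?S1];
      rewrite ?eqxx //; tauto.
  - by exists (invF h_inj j); rewrite -?hE f_invF.
  - exact: h_inj.
rewrite !big_ord_recl !big_ord0 !mulr1.
have -> : lift ord0 ord0 = 1 :> 'I_2 by apply: val_inj.
rewrite (_ : ord0 = 0 :> 'I_2) => [prodE|]; last exact: val_inj.
have cutw (d : 'I_2 -> R) i : cut_weight d [set i] = d 0 * d 1.
  move: i; apply: ord2_ind.
    by rewrite -S1 cut_weight1 // S1 mulrC.
  by rewrite -S0 cut_weight1 // S0.
have cc : c 0 * c 1 = c' 0 * c' 1.
  by have := cutE [set 0]; rewrite imset_set1 !cutw.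
have cc2 : c 0 ^+ 2 * c 1 ^+ 2 = c' 0 ^+ 2 * c' 1 ^+ 2.
  by rewrite -!exprMn cc.
have : (c 0 ^+ 2 - c' 0 ^+ 2) * (c 0 ^+ 2 - c' 1 ^+ 2) = 0.
  move: prodE cc2; move: (c 0 ^+ 2) (c 1 ^+ 2) (c' 0 ^+ 2) (c' 1 ^+ 2).
  move=> x y x' y' e1 e2.
  have e3 : x' + y' = x + y by move: e1 e2; nra.
  have -> : (x - x') * (x - y') = x ^+ 2 - x * (x' + y') + x' * y' by ring.
  by rewrite e3 -e2; ring.
move/eqP; rewrite mulf_eq0 !subr_eq0 => /orP[] /eqP c0E.
- exists id; apply: match_h => //; apply: ord2_ind => //.
  by move: prodE cc2; rewrite c0E => e1 e2; lra.
- exists (@ordS 2); apply: match_h; first exact: ordS_inj.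
  apply: ord2_ind; rewrite ?S0 ?S1 //.
  by move: prodE cc2; rewrite c0E => e1 e2; lra.
Qed.

Lemma vertex_matching_exists (R : realType) n (c c' : 'I_n -> R) p :
  (0 < n)%N -> (forall j, c j != 0) -> (forall j, c' j != 0) -> injective p ->
  (forall A : {set 'I_n}, cut_weight c A = cut_weight c' (p @: A)) ->
  \prod_j (1 - c j ^+ 2) = \prod_j (1 - c' j ^+ 2) ->
  exists h, vertex_matching c c' p h.
Proof.
case: n c c' p => [|[|[|n]]] c c' p // _ c0 c'0 p_inj cutE prodE.
- exists id; move: prodE; rewrite !big_ord1 => /addrI/oppr_inj c2E.
  have ord1_eq (x y : 'I_1) : x = y by rewrite [x]ord1 [y]ord1.
  split=> [i _|i _|j cj|i j _ _ _] //.
  + by rewrite (ord1_eq i ord0) c2E.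
  + by left; split; apply: ord1_eq.
  + by exists j; rewrite // (ord1_eq j ord0) c2E -(ord1_eq j ord0).
- exact: vertex_matching_2.
- exact: vertex_matching_gt2.
Qed.

Section MatchedVertices.
Variables (R : realType) (n : nat) (c c' : 'I_n -> R) (p h : 'I_n -> 'I_n).
Hypothesis cutE :
  forall A : {set 'I_n}, cut_weight c A = cut_weight c' (p @: A).
Hypothesis ph : vertex_matching c c' p h.

(** Along two consecutive non-exceptional vertices the matching of vertices
    keeps its orientation. *)
Lemma forward_succ i : c i ^+ 2 != 1 -> c (ordS i) ^+ 2 != 1 ->
  forward p h i -> forward p h (ordS i).
Proof.
move=> ci cSi [pi pSi]; have [//|[pSi' pSSi]] := vm_sides ph cSi.
have /(vm_inj ph ci cSi) eqi : h i = h (ordS i).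
  by apply: (@ordS_inj n); rewrite -pSi.
by rewrite -eqi; split; rewrite // {1}eqi.
Qed.

Lemma backward_succ i : c i ^+ 2 != 1 -> c (ordS i) ^+ 2 != 1 ->
  backward p h i -> backward p h (ordS i).
Proof.
move=> ci cSi [pi pSi]; have [[pSi' pSSi]|//] := vm_sides ph cSi.
have /(vm_inj ph ci cSi) eqi : h i = h (ordS i) by rewrite -pSi.
by rewrite -eqi; split; rewrite // {1}eqi.
Qed.

(** The cut weight of a single side is the product of the cosines at its two
    ends. *)
Lemma vertex_sign i : c i ^+ 2 != 1 -> c (ordS i) ^+ 2 != 1 ->
  c i * c (ordS i) = c' (h i) * c' (h (ordS i)).
Proof.
move=> ci cSi; have [n_gt1|n_le1] := ltnP 1 n; last first.
  have -> : ordS i = i.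
    by apply: ord_inj; rewrite val_ordS; have := ltn_ord i; case: ifP => /eqP; lia.
  by rewrite -!expr2 (vm_cos ph).
rewrite -cut_weight1 // cutE imset_set1.
have [fi|bi] := vm_sides ph ci.
  have [pSi _] := forward_succ ci cSi fi.
  by case: fi => _ pSi'; rewrite -pSi pSi' cut_weight1.
have [pSi _] := backward_succ ci cSi bi.
by case: bi => _ pSi'; rewrite pSi cut_weight1 // -pSi pSi' mulrC.
Qed.

End MatchedVertices.

(** * Polygons without exceptional angles *)

Section Cycle.
Variable n : nat.
Implicit Types i j : 'I_n.

Lemma iter_ordS k i : iter k (@ordS n) i = ((i + k) %% n)%N :> nat.
Proof.
elim: k => [|k IHk]; first by rewrite addn0 modn_small.
by rewrite iterS /= IHk -[(_ %% n).+1]addn1 modnDml addn1 addnS.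
Qed.

Lemma iter_ordS_inj i s t : (s < n)%N -> (t < n)%N ->
  iter s (@ordS n) i = iter t (@ordS n) i -> s = t.
Proof.
move=> s_lt t_lt /(congr1 (@nat_of_ord n)); rewrite !iter_ordS => /eqP.
by rewrite eqn_modDl !modn_small // => /eqP.
Qed.

Lemma ordS_cycle_ind (Q : 'I_n -> Prop) i :
  Q i -> (forall j, Q j -> Q (ordS j)) -> forall j, Q j.
Proof.
move=> Qi QS j; have Qiter k : Q (iter k (@ordS n) i) by elim: k => //= k /QS.
rewrite (_ : j = iter (n - i + j)%N (@ordS n) i) //; apply: ord_inj.
by rewrite iter_ordS addnA subnKC 1?ltnW // modnDl modn_small.
Qed.

Lemma modn_lt2 k : (k < n + n)%N -> (k %% n)%N = (if (k < n)%N then k else k - n)%N.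
Proof.
case: (ltnP k n) => [k_lt _|n_le k_lt]; first by rewrite modn_small.
rewrite -[in LHS](subnK n_le) modnDr modn_small // ltn_subLR //.
Qed.

End Cycle.

Lemma nth_rot T (x : T) k (s : seq T) i : (k <= size s)%N -> (i < size s)%N ->
  nth x (rot k s) i = nth x s ((k + i) %% size s)%N.
Proof.
move=> k_le i_lt; rewrite modn_lt2; last by lia.
rewrite nth_cat size_drop nth_drop; case: (ltnP i (size s - k)) => i_k.
  by case: (ltnP (k + i) (size s)) => //; lia.
rewrite nth_take; last by lia.
by case: (ltnP (k + i) (size s)) => ki; [lia | congr nth; lia].
Qed.

Lemma nth_reverse_lengths (R : realType) (x : R) (s : seq R) r :
  (r < size s)%N -> nth x (reverse_lengths s) r = nth x s ((size s - r) %% size s)%N.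
Proof.
case: s => //= y s r_lt; case: r r_lt => [|r] r_lt /=; first by rewrite subn0 modnn.
rewrite ltnS in r_lt; rewrite nth_rev // modn_small; last by lia.
by rewrite subSS (_ : size s - r = (size s - r.+1).+1)%N //; lia.
Qed.

Lemma size_reverse_lengths (R : realType) (s : seq R) :
  size (reverse_lengths s) = size s.
Proof. by case: s => //= y s; rewrite size_rev. Qed.

Lemma eq_from_nth_ord T (x : T) n (s s' : seq T) : size s = n -> size s' = n ->
  (forall i : 'I_n, nth x s i = nth x s' i) -> s = s'.
Proof.
move=> sn s'n eq_nth; apply: (@eq_from_nth _ x) => [|i]; first by rewrite sn.
by rewrite sn => i_lt; apply: (eq_nth (Ordinal i_lt)).
Qed.

Lemma eq_up_to_sign_nth (R : realType) n (s s' : seq R) (b : bool) :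
  size s = n -> size s' = n ->
  (forall i : 'I_n, nth 0 s i = (-1) ^+ b * nth 0 s' i) ->
  eq_up_to_sign s s'.
Proof.
move=> sn s'n; case: b => eq_nth; [right | left].
  apply: (@eq_from_nth_ord _ 0 n); rewrite ?size_map // => i.
  by rewrite (nth_map 0) ?s'n // eq_nth expr1 mulN1r.
by apply: (@eq_from_nth_ord _ 0 n) => // i; rewrite eq_nth expr0 mul1r.
Qed.

Section SignPropagation.
Variables (R : realType) (n : nat) (c c' : 'I_n -> R) (p h : 'I_n -> 'I_n).
Hypothesis cutE :
  forall A : {set 'I_n}, cut_weight c A = cut_weight c' (p @: A).
Hypothesis ph : vertex_matching c c' p h.

Lemma vertex_sign_base i : c i ^+ 2 != 1 ->
  exists b : bool, c i = (-1) ^+ b * c' (h i).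
Proof.
move=> ci; have /eqP := vm_cos ph ci; rewrite eq_sym eqf_sqr => /orP[] /eqP->.
  by exists false; rewrite mul1r.
by exists true; rewrite mulN1r.
Qed.

Lemma vertex_sign_succ (b : bool) i : c i != 0 ->
  c i ^+ 2 != 1 -> c (ordS i) ^+ 2 != 1 ->
  c i = (-1) ^+ b * c' (h i) -> c (ordS i) = (-1) ^+ b * c' (h (ordS i)).
Proof.
move=> ci0 ci cSi cE; apply: (mulfI ci0); rewrite (vertex_sign cutE ph ci cSi).
by rewrite cE mulrACA -expr2 sqrr_sign mul1r.
Qed.

End SignPropagation.

Lemma nth_cosine_vector (R : realType) n (alpha : n.-tuple R) (i : 'I_n) :
  nth 0 (cosine_vector alpha) i = angle_cos alpha i.
Proof. by rewrite (nth_map 0) ?size_tuple // -tnth_nth. Qed.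

(** If no vertex is exceptional, the matching has the same orientation
    everywhere, so it is a rotation or a reflection of the cycle of sides. *)
Lemma recover_cycle (R : realType) n (alpha l alpha' l' : n.-tuple R) p h :
  (0 < n)%N -> (forall j, angle_cos alpha j != 0) ->
  (forall j, tnth l' (p j) = tnth l j) ->
  (forall A : {set 'I_n},
     cut_weight (angle_cos alpha) A = cut_weight (angle_cos alpha') (p @: A)) ->
  vertex_matching (angle_cos alpha) (angle_cos alpha') p h ->
  (forall j, angle_cos alpha j ^+ 2 != 1) ->
  exists (s : nat) (b : bool),
    tval l = rot s (orient_lengths b l') /\
    eq_up_to_sign (cosine_vector alpha)
      (rot s (orient_cosines b (cosine_vector alpha'))).
Proof.
move=> n_gt0 c0 lp cutE ph nonexc; pose i0 := Ordinal n_gt0.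
have [b0 sign0] := vertex_sign_base ph (nonexc i0).
have signE : forall i, angle_cos alpha i = (-1) ^+ b0 * angle_cos alpha' (h i).
  by apply: (ordS_cycle_ind sign0) => j; apply: vertex_sign_succ.
have nthl (u : n.-tuple R) (i : 'I_n) : nth 0 u i = tnth u i.
  by rewrite (tnth_nth 0).
case: (vm_sides ph (nonexc i0)) => dir0.
- have dir : forall i, forward p h i.
    by apply: (ordS_cycle_ind dir0) => j; apply: (forward_succ ph).
  have pE : forall i, p i = ((p i0 + i) %% n)%N :> nat.
    apply: (@ordS_cycle_ind _ _ i0) => [|i IHi]; first by rewrite addn0 modn_small.
    rewrite (dir i).2 -(dir i).1 /= IHi -addn1 modnDml -addnA addn1.
    by rewrite modnDmr.
  exists (p i0), false; split; rewrite /orient_lengths /orient_cosines.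
    apply: (@eq_from_nth_ord _ 0 n); rewrite ?size_rot ?size_tuple // => i.
    by rewrite nth_rot ?size_tuple ?(ltnW (ltn_ord (p i0))) // -pE !nthl lp.
  apply: (@eq_up_to_sign_nth _ n _ _ b0); rewrite ?size_rot ?size_tuple // => i.
  rewrite nth_rot ?size_tuple ?(ltnW (ltn_ord (p i0))) //.
  rewrite -pE !nth_cosine_vector signE.
  by rewrite (dir i).1.
have dir : forall i, backward p h i.
  by apply: (ordS_cycle_ind dir0) => j; apply: (backward_succ ph).
have pE : forall i, ((p i + i) %% n)%N = p i0.
  apply: (@ordS_cycle_ind _ _ i0) => [|i <-]; first by rewrite addn0 modn_small.
  by rewrite (dir i).2 (dir i).1 /= modnDmr modnDml addSn addnS.
(* The reflected side [p i] is [p i0 - i] modulo [n], and the vertex [h i] is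
   its predecessor. *)
exists (n - p i0)%N, true; split; rewrite /orient_lengths /orient_cosines.
  apply: (@eq_from_nth_ord _ 0 n);
    rewrite ?size_rot ?size_reverse_lengths ?size_tuple // => i.
  rewrite nth_rot ?size_reverse_lengths ?size_tuple ?leq_subr //.
  rewrite (nth_reverse_lengths 0) ?size_tuple ?ltn_pmod //.
  rewrite nthl -lp -nthl; congr (nth _ _ _).
  have := pE i; have := (ltn_ord (p i), ltn_ord (p i0), ltn_ord i) => -[[]].
  move=> p_lt p0_lt i_lt; rewrite modn_lt2; last by lia.
  rewrite [((_ - _ + _) %% n)%N]modn_lt2; last by lia.
  rewrite modn_lt2; last by lia.
  by do ![case: ifP]; lia.
apply: (@eq_up_to_sign_nth _ n _ _ b0);
  rewrite ?size_rot ?size_rev ?size_tuple // => i.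
rewrite nth_rot ?size_rev ?size_tuple ?leq_subr // nth_rev ?size_tuple ?ltn_pmod //.
rewrite nth_cosine_vector signE -nth_cosine_vector; congr (_ * nth _ _ _).
have := pE i; have := congr1 (@nat_of_ord n) (dir i).1; rewrite val_ordS.
have := (ltn_ord (p i), ltn_ord (p i0), ltn_ord i, ltn_ord (h i)) => -[[[]]].
move=> p_lt p0_lt i_lt h_lt; rewrite modn_lt2; last by lia.
rewrite modn_lt2; last by lia.
by do ![case: ifP => [/eqP|/eqP]|case: ifP]; lia.
Qed.

(** * Exceptional boundary components *)

Lemma traject_mkseq (T : Type) (f : T -> T) x k :
  traject f x k = mkseq (fun t => iter t f x) k.
Proof. by elim: k => // k IHk; rewrite trajectSr IHk mkseqS. Qed.

Section Component.
Variables (R : realType) (n : nat) (alpha : n.-tuple R).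
Hypothesis alpha_itv : forall j, 0 < tnth alpha j < pi.
Implicit Types (v : exceptional_vertex alpha) (j : 'I_n).

Lemma exceptionalP j : `[< exceptional (tnth alpha j) >] =
  (angle_cos alpha j ^+ 2 == 1).
Proof.
have [ex_cos cos_ex] := exceptional_cos2 (alpha_itv j).
by apply/asboolP/eqP.
Qed.

Lemma exceptional_vertex_cos v : angle_cos alpha (val v) ^+ 2 = 1.
Proof. by apply/eqP; rewrite -exceptionalP; exact: (valP v). Qed.

(** The [t]-th side of the component that starts at the vertex [v]. *)
Definition component_side v t : 'I_n := iter t (@ordS n) (ordS (val v)).

Lemma component_sideS v t :
  component_side v t.+1 = ordS (component_side v t).
Proof. by []. Qed.

Lemma nth_indices_after j0 j t : (t < n)%N ->
  nth j0 (indices_after j) t = iter t (@ordS n) (ordS j).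
Proof.
by move=> t_lt; rewrite /indices_after traject_mkseq nth_mkseq.
Qed.

(** [component_size v] is the only [k] such that the first [k.-1] vertices after
    [v] are not exceptional and the next one is. *)
Lemma component_size_char v k : (0 < k <= n)%N ->
  (forall t, (t.+1 < k)%N -> angle_cos alpha (component_side v t) ^+ 2 != 1) ->
  angle_cos alpha (component_side v k.-1) ^+ 2 = 1 -> component_size v = k.
Proof.
move=> /andP[k_gt0 k_le] inner last_exc.
have k1_lt : (k.-1 < n)%N by lia.
rewrite -(prednK k_gt0) /component_size; congr _.+1.
set q := fun j => _; set s := indices_after _.
have s_size : size s = n by rewrite size_traject.
have s_has : has q s.
  apply/hasP; exists (nth (val v) s k.-1); first by rewrite mem_nth ?s_size.
  by rewrite /q exceptionalP nth_indices_after //; apply/eqP.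
apply/eqP; rewrite eqn_leq; apply/andP; split; rewrite leqNgt; apply/negP => lt.
  have := before_find (val v) lt; rewrite /q exceptionalP nth_indices_after //.
  by rewrite -/(component_side v _) last_exc eqxx.
have find_k : ((find q s).+1 < k)%N by lia.
have := nth_find (val v) s_has; rewrite {1}/q exceptionalP nth_indices_after.
  by rewrite -/(component_side v _) (negPf (inner _ find_k)).
exact: ltn_trans lt _.
Qed.

Lemma component_sizeP v : [/\ (0 < component_size v <= n)%N,
  (forall t, (t.+1 < component_size v)%N ->
     angle_cos alpha (component_side v t) ^+ 2 != 1) &
  angle_cos alpha (component_side v (component_size v).-1) ^+ 2 = 1].
Proof.
have n_gt0 : (0 < n)%N by apply: leq_ltn_trans (ltn_ord (val v)).
pose q j := `[< exceptional (tnth alpha j) >].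
have s_has : has q (indices_after (val v)).
  apply/hasP; exists (val v); last exact: (valP v).
  apply/trajectP; exists n.-1; first by rewrite prednK.
  by rewrite -iterSr prednK //; apply: ord_inj; rewrite iter_ordS modnDr modn_small.
have find_lt : (find q (indices_after (val v)) < n)%N.
  by move: s_has; rewrite has_find size_traject.
split=> [|t t_lt|]; first by [].
  have := before_find (val v) (t_lt : (t < find q (indices_after (val v)))%N).
  rewrite nth_indices_after; last exact: ltn_trans find_lt.
  by rewrite /q exceptionalP => ->.
have := nth_find (val v) s_has; rewrite nth_indices_after // /q exceptionalP.
by move=> /eqP.
Qed.

Lemma component_sidesE v :
  component_sides v = mkseq (component_side v) (component_size v).
Proof.
have [/andP[_ k_le] _ _] := component_sizeP v.
by rewrite /component_sides take_traject // traject_mkseq.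
Qed.

Lemma component_lengthsE (l : n.-tuple R) v : component_lengths l v =
  mkseq (fun t => tnth l (component_side v t)) (component_size v).
Proof. by rewrite /component_lengths component_sidesE -map_comp. Qed.

Lemma component_cosinesE v : component_cosines v =
  mkseq (fun t => angle_cos alpha (component_side v t)) (component_size v).-1.
Proof.
by rewrite /component_cosines component_sidesE -map_take take_iota
  (minn_idPl (leq_pred _)) -map_comp.
Qed.

Lemma last_component_sides v : last (val v) (component_sides v) =
  component_side v (component_size v).-1.
Proof.
have [/andP[k_gt0 _] _ _] := component_sizeP v.
by rewrite component_sidesE (last_nth (val v)) size_mkseq -(prednK k_gt0) /=
  nth_mkseq.
Qed.

Lemma mem_component v j : reflect
  (exists2 t, (t < component_size v)%N & j = component_side v t)
  (j \in component_sides v).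
Proof.
rewrite component_sidesE; apply: (iffP mapP) => -[t].
  by rewrite mem_iota => t_lt ->; exists t.
by move=> t_lt ->; exists t; rewrite ?mem_iota.
Qed.

Lemma exceptional_component_end v j : angle_cos alpha j ^+ 2 = 1 ->
  (j \in component_sides v) = (j == component_side v (component_size v).-1).
Proof.
have [/andP[k_gt0 k_le] inner _] := component_sizeP v => cj.
apply/mem_component/eqP => [[t t_lt jE]|->]; last first.
  by exists (component_size v).-1; rewrite // prednK.
have [t_lt1|t_ge] := ltnP t.+1 (component_size v).
  by have := inner _ t_lt1; rewrite -jE cj eqxx.
by rewrite jE; congr component_side; lia.
Qed.

Lemma exceptional_component_start v j : angle_cos alpha j ^+ 2 = 1 ->
  (ordS j \in component_sides v) = (j == val v).
Proof.
have [/andP[k_gt0 k_le] inner _] := component_sizeP v => cj.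
apply/mem_component/eqP => [[[|t] t_lt]|->]; last by exists 0%N.
  by move=> /ordS_inj.
rewrite component_sideS => /ordS_inj jE.
by have := inner _ t_lt; rewrite -jE cj eqxx.
Qed.

Lemma inner_component v j : angle_cos alpha j ^+ 2 != 1 ->
  (ordS j \in component_sides v) = (j \in component_sides v).
Proof.
have [/andP[k_gt0 k_le] inner last_exc] := component_sizeP v => cj.
apply/mem_component/mem_component => [[[|t] t_lt]|[t t_lt jE]].
- by move=> /ordS_inj jE; rewrite jE exceptional_vertex_cos eqxx in cj.
- by rewrite component_sideS => /ordS_inj jE; exists t; rewrite // ltnW.
- exists t.+1; rewrite ?component_sideS ?jE //.
  rewrite ltn_neqAle t_lt andbT; apply/eqP => tE.
  by move: cj; rewrite jE -[t]/(t.+1.-1) tE last_exc eqxx.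
Qed.

(** The sides of a component are cut off from the others exactly at the two
    exceptional ends of the component. *)
Lemma component_cut v : cut_weight (angle_cos alpha) [set j in component_sides v] =
  angle_cos alpha (val v) *
  angle_cos alpha (component_side v (component_size v).-1).
Proof.
have [_ _ last_exc] := component_sizeP v; have v_exc := exceptional_vertex_cos v.
set u := component_side _ _ in last_exc *.
transitivity (\prod_(j | (j == u) != (j == val v)) angle_cos alpha j).
  apply: eq_bigl => j; rewrite !inE.
  have [cj|cj] := eqVneq (angle_cos alpha j ^+ 2) 1.
    by rewrite exceptional_component_end // exceptional_component_start.
  rewrite inner_component // eqxx; apply/esym/negbTE; rewrite negbK.
  have /negPf-> : j != u by apply: contraNneq cj => ->; apply/eqP.
  have /negPf-> // : j != val v by apply: contraNneq cj => ->; apply/eqP.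
have [->|uv] := eqVneq u (val v).
  by rewrite -expr2 v_exc big1 // => j; rewrite eqxx.
rewrite (bigD1 (val v)) /=; last by rewrite eqxx (eq_sym _ u) (negPf uv).
congr (_ * _); apply: big_pred1 => j /=.
have [->|_] := eqVneq j u; first by rewrite uv.
by case: (j == val v).
Qed.

(** The parity of a component can thus be read off a cut weight. *)
Lemma component_evenE v :
  component_even v <-> cut_weight (angle_cos alpha) [set j in component_sides v] = 1.
Proof.
rewrite /component_even last_component_sides component_cut.
rewrite -!/(angle_cos alpha _); have := exceptional_vertex_cos v.
rewrite expr2 => cc; split=> [<- //|cu]; rewrite -[in RHS](mul1r (angle_cos _ _)).
by rewrite -cc -mulrA cu mulr1.
Qed.

End Component.

Section ComponentMatching.
Variables (R : realType) (n : nat) (alpha l alpha' l' : n.-tuple R).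
Variables (p h : 'I_n -> 'I_n).
Hypothesis alpha_itv : forall j, 0 < tnth alpha j < pi.
Hypothesis alpha'_itv : forall j, 0 < tnth alpha' j < pi.
Hypothesis c_neq0 : forall j, angle_cos alpha j != 0.
Hypothesis p_inj : injective p.
Hypothesis lp : forall j, tnth l' (p j) = tnth l j.
Hypothesis cutE : forall A : {set 'I_n},
  cut_weight (angle_cos alpha) A = cut_weight (angle_cos alpha') (p @: A).
Hypothesis ph : vertex_matching (angle_cos alpha) (angle_cos alpha') p h.

Section OneComponent.
Variable v : exceptional_vertex alpha.
Local Notation k := (component_size v).
Local Notation a := (component_side v).

Let k_bounds : (0 < k <= n)%N.
Proof. by have [] := component_sizeP alpha_itv v. Qed.

Let inner t : (t.+1 < k)%N -> angle_cos alpha (a t) ^+ 2 != 1.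
Proof. by have [_ + _] := component_sizeP alpha_itv v; apply. Qed.

Let last_exc : angle_cos alpha (a k.-1) ^+ 2 = 1.
Proof. by have [] := component_sizeP alpha_itv v. Qed.

Let side_inj s t : (s < k)%N -> (t < k)%N -> p (a s) = p (a t) -> s = t.
Proof.
move=> s_lt t_lt /p_inj; have /andP[_ k_le] := k_bounds.
by apply: iter_ordS_inj; apply: leq_trans k_le.
Qed.

Lemma component_direction :
  (forall t, (t.+1 < k)%N -> forward p h (a t)) \/
  (forall t, (t.+1 < k)%N -> backward p h (a t)).
Proof.
have [k_gt1|k_le1] := ltnP 1 k; last first.
  by left=> t; rewrite ltnNge (leq_trans k_le1).
have [dir0|dir0] := vm_sides ph (inner k_gt1); [left | right];
  elim=> [//|t IHt t_lt]; have t_lt' := ltnW t_lt.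
- by apply: (forward_succ ph); [exact: inner | exact: (inner t_lt) | exact: IHt].
- by apply: (backward_succ ph); [exact: inner | exact: (inner t_lt) | exact: IHt].
Qed.

Lemma component_sign : exists b : bool, forall t, (t.+1 < k)%N ->
  angle_cos alpha (a t) = (-1) ^+ b * angle_cos alpha' (h (a t)).
Proof.
have [k_gt1|k_le1] := ltnP 1 k; last first.
  by exists false => t; rewrite ltnNge (leq_trans k_le1).
have [b b0] := vertex_sign_base ph (inner k_gt1); exists b.
elim=> [//|t IHt t_lt]; have t_lt' := ltnW t_lt.
by apply: (vertex_sign_succ cutE ph) => //;
  [exact: inner | exact: (inner t_lt) | exact: IHt].
Qed.

(** The only non-exceptional vertices whose images touch the image of the side
    [a t] are the inner vertices [a t] and [a t.-1] of the component. *)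
Let incident_vertex e t : angle_cos alpha e ^+ 2 != 1 -> (t < k)%N ->
  p (a t) = h e \/ p (a t) = ordS (h e) ->
  (e = a t /\ (t.+1 < k)%N) \/ (0 < t)%N /\ e = a t.-1.
Proof.
move=> ce t_lt pa.
have : p (a t) = p e \/ p (a t) = p (ordS e).
  by case: (vm_sides ph ce) pa => -[-> ->] [] ->; [left | right | right | left].
case=> /p_inj eE; [left | right].
  split=> //; rewrite ltn_neqAle t_lt andbT; apply/eqP => tE.
  by move: ce; rewrite -eE -[t]/(t.+1.-1) tE last_exc eqxx.
case: t t_lt eE {pa} => [|t] t_lt.
  by move=> /ordS_inj eE; move: ce; rewrite -eE exceptional_vertex_cos ?eqxx.
by rewrite component_sideS => /ordS_inj ->.
Qed.

Let exceptional_vertex_of j : angle_cos alpha' j ^+ 2 = 1 ->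
  {w : exceptional_vertex alpha' | val w = j}.
Proof.
by move=> cj; apply: (exist _ (Sub j _)); rewrite ?SubK // exceptionalP // cj eqxx.
Qed.

(** In the forward case, the images of the sides of the component of [v] form,
    in the same order, a component of the other polygon. *)
Lemma forward_component : (forall t, (t.+1 < k)%N -> forward p h (a t)) ->
  exists w : exceptional_vertex alpha', component_size w = k /\
    forall t, (t < k)%N -> component_side w t = p (a t).
Proof.
move=> dir; have /andP[k_gt0 k_le] := k_bounds.
have start_exc : angle_cos alpha' (ord_pred (p (a 0%N))) ^+ 2 = 1.
  apply/eqP/negPn/negP => /(vm_onto ph)[e ce he].
  have pa : p (a 0%N) = ordS (h e) by rewrite he ord_predK.
  have [[eE k_gt1]|[]//] := incident_vertex ce k_gt0 (or_intror pa).
  move: pa; rewrite eE (dir _ k_gt1).1 => /esym/eqP.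
  by rewrite (negPf (ordS_neq _ _)) // (leq_trans k_gt1).
have end_exc : angle_cos alpha' (p (a k.-1)) ^+ 2 = 1.
  apply/eqP/negPn/negP => /(vm_onto ph)[e ce he].
  have k1_lt : (k.-1 < k)%N by lia.
  have [[_]|[k1_gt0 eE]] := incident_vertex ce k1_lt (or_introl (esym he)).
    by lia.
  have k2_lt : (k.-1.-1.+1 < k)%N by lia.
  move: he; rewrite eE -(dir _ k2_lt).1 => /side_inj; lia.
have [w wE] := exceptional_vertex_of start_exc.
have w_side t : (t < k)%N -> component_side w t = p (a t).
  elim: t => [_|t IHt t_lt]; first by rewrite /component_side /= wE ord_predK.
  by rewrite !component_sideS IHt ?(dir t t_lt).2 ?(dir t t_lt).1 // ltnW.
exists w; split=> //; apply: component_size_char => // [t t_lt|].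
  have t_lt' := ltnW t_lt.
  by rewrite w_side // (dir t t_lt).1 (vm_cos ph) inner.
by rewrite w_side //; lia.
Qed.

(** In the backward case, the same holds with the order reversed. *)
Lemma backward_component : (forall t, (t.+1 < k)%N -> backward p h (a t)) ->
  exists w : exceptional_vertex alpha', component_size w = k /\
    forall t, (t < k)%N -> component_side w t = p (a (k.-1 - t)).
Proof.
move=> dir; have /andP[k_gt0 k_le] := k_bounds.
have k1_lt : (k.-1 < k)%N by lia.
have start_exc : angle_cos alpha' (ord_pred (p (a k.-1))) ^+ 2 = 1.
  apply/eqP/negPn/negP => /(vm_onto ph)[e ce he].
  have pa : p (a k.-1) = ordS (h e) by rewrite he ord_predK.
  have [[_]|[k1_gt0 eE]] := incident_vertex ce k1_lt (or_intror pa); first by lia.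
  have k2_lt : (k.-1.-1.+1 < k)%N by lia.
  move: pa; rewrite -[in LHS](prednK k1_gt0) component_sideS (dir _ k2_lt).2 -eE.
  by move=> /esym/eqP; rewrite (negPf (ordS_neq _ _)) //; lia.
have end_exc : angle_cos alpha' (p (a 0%N)) ^+ 2 = 1.
  apply/eqP/negPn/negP => /(vm_onto ph)[e ce he].
  have [[eE k_gt1]|[]//] := incident_vertex ce k_gt0 (or_introl (esym he)).
  by move: he; rewrite eE -(dir _ k_gt1).2 -component_sideS => /side_inj; lia.
have [w wE] := exceptional_vertex_of start_exc.
have w_side t : (t < k)%N -> component_side w t = p (a (k.-1 - t)).
  elim: t => [_|t IHt t_lt].
    by rewrite /component_side /= wE ord_predK subn0.
  have s_lt : ((k.-1 - t.+1).+1 < k)%N by lia.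
  have tE : (k.-1 - t = (k.-1 - t.+1).+1)%N by lia.
  have := IHt (ltnW t_lt); rewrite tE component_sideS (dir _ s_lt).2 => wE'.
  by rewrite component_sideS wE' (dir _ s_lt).1.
exists w; split=> //; apply: component_size_char => // [t t_lt|].
  have s_lt : ((k.-1 - t.+1).+1 < k)%N by lia.
  have tE : (k.-1 - t = (k.-1 - t.+1).+1)%N by lia.
  have := w_side t (ltnW t_lt); rewrite tE component_sideS (dir _ s_lt).2 => ->.
  by rewrite (vm_cos ph) inner.
by rewrite w_side // subnn.
Qed.

Lemma component_match : exists w : exceptional_vertex alpha',
  component_sides w =i map p (component_sides v) /\ same_component l l' v w.
Proof.
have /andP[k_gt0 k_le] := k_bounds; have [b sign_b] := component_sign.
have even_of (w : exceptional_vertex alpha') :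
    component_sides w =i map p (component_sides v) ->
    component_even v <-> component_even w.
  move=> sides_w; rewrite !component_evenE // cutE (_ : _ @: _ =
    [set j in component_sides w]) //.
  apply/setP => j; rewrite inE sides_w; apply/imsetP/mapP => -[i].
    by rewrite inE => iv ->; exists i.
  by move=> iv ->; exists i; rewrite ?inE.
case: component_direction => dir.
- have [w [kw w_side]] := forward_component dir.
  have sides_w : component_sides w = map p (component_sides v).
    rewrite !component_sidesE // kw -map_comp; apply/eq_in_map => t.
    by rewrite mem_iota => /w_side.
  exists w; split; first by rewrite sides_w.
  split=> //; first by apply: even_of; rewrite sides_w.
  left; split.
    by rewrite /component_lengths sides_w -map_comp; apply: eq_map => j /=.
  apply: (@eq_up_to_sign_nth _ k.-1 _ _ b);
    rewrite ?component_cosinesE ?size_mkseq ?kw // => t.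
  have t_lt : (t.+1 < k)%N by have := ltn_ord t; lia.
  rewrite !nth_mkseq // sign_b // w_side; last exact: ltnW.
  by rewrite (dir t t_lt).1.
- have [w [kw w_side]] := backward_component dir.
  have sides_w : component_sides w = rev (map p (component_sides v)).
    rewrite !component_sidesE // kw.
    apply: (@eq_from_nth_ord _ (val v) k);
      rewrite ?size_rev ?size_map ?size_iota // => t.
    rewrite nth_rev ?size_map ?size_iota // (nth_map (val v)); last first.
      by rewrite size_mkseq; have := ltn_ord t; lia.
    rewrite !nth_mkseq //; last by have := ltn_ord t; lia.
    by rewrite w_side //; congr (p (a _)); have := ltn_ord t; lia.
  have sides_w' : component_sides w =i map p (component_sides v).
    by move=> j; rewrite sides_w mem_rev.
  exists w; split=> //; split=> //; first exact: even_of.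
  right; split.
    rewrite /component_lengths sides_w map_rev revK -map_comp.
    by apply: eq_map => j /=.
  apply: (@eq_up_to_sign_nth _ k.-1 _ _ b);
    rewrite ?component_cosinesE ?size_rev ?size_mkseq ?kw // => t.
  have t_lt : (t.+1 < k)%N by have := ltn_ord t; lia.
  rewrite nth_rev ?size_mkseq // !nth_mkseq //; last by lia.
  rewrite sign_b // w_side; last by lia.
  rewrite (_ : k.-1 - (k.-1 - t.+1) = t.+1)%N; last by lia.
  by rewrite component_sideS (dir t t_lt).2.
Qed.

End OneComponent.

(** The component determines its starting vertex, so the matching of components
    is injective. *)
Lemma component_injection :
  exists2 f : exceptional_vertex alpha -> exceptional_vertex alpha',
    injective f & forall v, same_component l l' v (f v).
Proof.
have [f fP] := fin_all_exists component_match.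
exists f => [v w fvw|v]; last by case: (fP v).
have sub : {subset component_sides v <= component_sides w}.
  move=> j jv; have := map_f p jv.
  by rewrite -(fP v).1 fvw (fP w).1 mem_map.
have v_cos := exceptional_vertex_cos alpha_itv v.
have : ordS (val v) \in component_sides w.
  by apply: sub; rewrite exceptional_component_start.
by rewrite exceptional_component_start // => /eqP/val_inj.
Qed.

End ComponentMatching.

(** * Assembling the data recovered from the characteristic polynomial *)

Section Recovery.
Variable R : realType.

(** What the recovery uses of an admissible polygon; the geometry enters through
    these conditions only. *)
Definition admissible_data n (alpha l : n.-tuple R) : Prop :=
  [/\ (0 < n)%N, forall j, 0 < tnth alpha j < pi, forall j, 0 < tnth l j,
      forall j, angle_cos alpha j != 0 & incommensurable l].

Lemma polygon_admissible_data n (alpha l : n.-tuple R) Om side :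
  is_curvilinear_polygon alpha l Om side -> admissible alpha l ->
  admissible_data alpha l.
Proof.
move=> poly [not_special l_inc]; have alpha_itv := polygon_angles poly.
split=> // [||j]; first exact: (polygon_vertices_gt0 poly).
  exact: (polygon_lengths poly).
by apply/eqP => /(special_cos_eq0 (alpha_itv j)); apply: not_special.
Qed.

(** The total length is the largest signed sum. *)
Lemma total_length_le n m (alpha l : n.-tuple R) (alpha' l' : m.-tuple R) :
  admissible_data alpha l -> admissible_data alpha' l' ->
  charF alpha l =1 charF alpha' l' ->
  balance (tnth l) set0 <= balance (tnth l') set0.
Proof.
move=> [n_gt0 _ _ c0 l_inc] [m_gt0 _ l'_gt0 _ l'_inc] eqF.
have [A' [-> _]] := charF_match n_gt0 m_gt0 l_inc l'_inc c0 eqF set0.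
rewrite balance_subset_sum gerBl mulr_ge0 // sumr_ge0 // => j _.
exact: ltW.
Qed.

(** The sides correspond to each other in such a way that lengths and cut
    weights agree: subset sums give the lengths, and then the set [A'] with the
    same signed sum as [A] can only be the image of [A]. *)
Lemma recover_sides n m (alpha l : n.-tuple R) (alpha' l' : m.-tuple R) :
  admissible_data alpha l -> admissible_data alpha' l' ->
  charF alpha l =1 charF alpha' l' ->
  exists p : 'I_n -> 'I_m,
    [/\ injective p, forall i, tnth l' (p i) = tnth l i &
     forall A : {set 'I_n},
       cut_weight (angle_cos alpha) A = cut_weight (angle_cos alpha') (p @: A)].
Proof.
move=> dataP dataQ eqF; have eqF' : charF alpha' l' =1 charF alpha l by move=> s.
have [n_gt0 _ l_gt0 c0 l_inc] := dataP; have [m_gt0 _ l'_gt0 c'0 l'_inc] := dataQ.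
have total : balance (tnth l) set0 = balance (tnth l') set0.
  apply/le_anti; rewrite (total_length_le dataP dataQ eqF).
  exact: total_length_le dataQ dataP eqF'.
have sums (A : {set 'I_n}) (A' : {set 'I_m}) :
    balance (tnth l) A = balance (tnth l') A' <->
    \sum_(j in A) tnth l j = \sum_(j in A') tnth l' j.
  rewrite balance_subset_sum [in RHS]balance_subset_sum total.
  split=> [/addrI/oppr_inj/mulfI->//|->//]; by rewrite pnatr_eq0.
have matchP := charF_match n_gt0 m_gt0 l_inc l'_inc c0 eqF.
have matchQ := charF_match m_gt0 n_gt0 l'_inc l_inc c'0 eqF'.
have [||p p_inj pE] := side_match l_gt0 l'_gt0 l_inc l'_inc.
- by move=> A; have [A' [/sums AA' _]] := matchP A; exists A'.
- by move=> A'; have [A [/esym/sums AA' _]] := matchQ A'; exists A.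
exists p; split=> // A; have [A' [bA ->]] := matchP A.
congr (cut_weight _ _); apply: (balance_inj l'_inc); rewrite -bA; apply/sums.
by rewrite big_imset /=; [apply: eq_bigr | move=> ? ? _ _ /p_inj].
Qed.

(** The constant term of [charF] is the product of the sines, whose square is
    the product of the [1 - c j ^+ 2]. *)
Lemma recover_vertices n (alpha l alpha' l' : n.-tuple R) :
  admissible_data alpha l -> admissible_data alpha' l' ->
  charF alpha l =1 charF alpha' l' ->
  exists p h : 'I_n -> 'I_n,
    [/\ injective p, forall i, tnth l' (p i) = tnth l i,
     forall A : {set 'I_n},
       cut_weight (angle_cos alpha) A = cut_weight (angle_cos alpha') (p @: A) &
     vertex_matching (angle_cos alpha) (angle_cos alpha') p h].
Proof.
move=> dataP dataQ eqF; have [p [p_inj pE cutE]] := recover_sides dataP dataQ eqF.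
have [n_gt0 _ _ c0 l_inc] := dataP; have [_ _ _ c'0 l'_inc] := dataQ.
have sin_prod (beta : n.-tuple R) : \prod_j (1 - angle_cos beta j ^+ 2) =
    (\prod_j sin (pi ^+ 2 / (2 * tnth beta j))) ^+ 2.
  by rewrite -prodrXl; apply: eq_bigr => j _; rewrite sin2cos2.
have [|h ph] := vertex_matching_exists n_gt0 c0 c'0 p_inj cutE.
  by rewrite !sin_prod (charF_const n_gt0 n_gt0 l_inc l'_inc eqF).
by exists p, h.
Qed.

Lemma recover_components n (alpha l alpha' l' : n.-tuple R) :
  admissible_data alpha l -> admissible_data alpha' l' ->
  charF alpha l =1 charF alpha' l' ->
  exists2 f : exceptional_vertex alpha -> exceptional_vertex alpha',
    injective f & forall v, same_component l l' v (f v).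
Proof.
move=> dataP dataQ eqF.
have [p [h [p_inj pE cutE ph]]] := recover_vertices dataP dataQ eqF.
have [_ alpha_itv _ c0 _] := dataP; have [_ alpha'_itv _ _ _] := dataQ.
exact: component_injection alpha_itv alpha'_itv c0 p_inj pE cutE ph.
Qed.

End Recovery.

Theorem theorem1p17 (R : realType) (n m : nat)
  (alpha l : n.-tuple R) (Om : set (R * R)) (side : 'I_n -> R -> R * R)
  (alpha' l' : m.-tuple R) (Om' : set (R * R)) (side' : 'I_m -> R -> R * R)
  (polyP : is_curvilinear_polygon alpha l Om side)
  (polyQ : is_curvilinear_polygon alpha' l' Om' side')
  (admP : admissible alpha l)
  (admQ : admissible alpha' l')
  (eqF : forall sigma : R, charF alpha l sigma = charF alpha' l' sigma) :
  [/\ n = m,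
      nb_exceptional alpha = nb_exceptional alpha',
      nb_exceptional alpha = 0%N ->
        exists (s : nat) (b : bool),
          tval l = rot s (orient_lengths b l') /\
          eq_up_to_sign (cosine_vector alpha)
            (rot s (orient_cosines b (cosine_vector alpha')))
    & (1 <= nb_exceptional alpha)%N ->
        exists2 f : exceptional_vertex alpha -> exceptional_vertex alpha',
          bijective f & forall v, same_component l l' v (f v)].
Proof.
have dataP := polygon_admissible_data polyP admP.
have dataQ := polygon_admissible_data polyQ admQ.
have eqF' : charF alpha' l' =1 charF alpha l by move=> s.
clear Om side polyP admP Om' side' polyQ admQ.
(* Both numbers of vertices are bounded by each other, by injections of sides. *)
have nm : n = m.
  have [p [/leq_card + _ _]] := recover_sides dataP dataQ eqF.
  have [q [/leq_card + _ _]] := recover_sides dataQ dataP eqF'.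
  by rewrite !card_ord => mn le_nm; apply/eqP; rewrite eqn_leq le_nm.
subst m.
have [f f_inj f_same] := recover_components dataP dataQ eqF.
have [g g_inj _] := recover_components dataQ dataP eqF'.
have eq_nb : nb_exceptional alpha = nb_exceptional alpha'.
  by apply/eqP; rewrite eqn_leq (leq_card f) // (leq_card g).
split=> // [nb0|_]; last first.
  by exists f => //; apply: inj_card_bij f_inj _; move: eq_nb; rewrite /nb_exceptional => ->.
have [p [h [_ pE cutE ph]]] := recover_vertices dataP dataQ eqF.
have [n_gt0 alpha_itv _ c0 _] := dataP.
apply: recover_cycle cutE ph _ => // j.
rewrite -exceptionalP //; apply/negP => j_exc.
by have /card0_eq/(_ (Sub j j_exc)) := nb0.
Qed.
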